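(* Let $k$ be a field and $d\ge2$ an integer. Let $u=x_1^{a_1}\cdots x_n^{a_n}$ and $v=x_2^{b_2}\cdots x_n^{b_n}$ be monomials of degree $d$ in $k[x_1,\ldots,x_n]$, with $a_1\ne0$. Suppose that the ideal $I=(\mathcal L(u,v))$ is not a completely lexsegment ideal. Then $I$ has a linear resolution if and only if $I$ has linear quotients.
   Context: Let $S=k[x_1,\ldots,x_n]$, with monomials ordered lexicographically, $x_1>\cdots>x_n$. $\mathcal M_d$ is the set of monomials of degree $d$ of $S$ and $\mathcal L(u,v)=\{w\in\mathcal M_d: u\ge_{lex}w\ge_{lex}v\}$ is the lexsegment determined by $u,v$. The shadow of a set $\mathcal L$ of monomials is $\mathrm{Shad}(\mathcal L)=\{x_iw: w\in\mathcal L,\ 1\le i\le n\}$; the ideal $(\mathcal L(u,v))$ is a completely lexsegment ideal if all iterated shadows of $\mathcal L(u,v)$ are lexsegments. A monomial ideal has linear quotients if its minimal monomial generators can be ordered $u_1,\ldots,u_m$ such that for every $i\ge 2$ the colon ideal $(u_1,\ldots,u_{i-1}):u_i$ is generated by a subset of the variables. An ideal $I$ generated in degree $d$ has a linear resolution if $\mathrm{Tor}^S_i(I,k)_{i+j}=0$ for all $i$ and all $j\ne d$. *)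

(* Defs.v *)
From HB Require Import structures.
From mathcomp Require Import all_boot all_order all_algebra.
From mathcomp Require Export mpoly.

Set Implicit Arguments.
Unset Strict Implicit.
Unset Printing Implicit Defensive.

Import Order.TTheory GRing.Theory.
Local Open Scope ring_scope.

Section Lexsegments.

Variable n : nat.
Implicit Types (m u v w : 'X_{1..n}) (A : 'X_{1..n} -> Prop).

(* The lexicographic order on exponent vectors: the monomial with the larger
   exponent at the first index where they differ is the larger one, so that
   x_1 > ... > x_n. *)
Definition lex_le m1 m2 : bool :=
  ((m1 : seqlexi nat) <= (m2 : seqlexi nat))%O.

Definition lexseg (d : nat) u v : 'X_{1..n} -> Prop :=
  fun w => [/\ mdeg w = d, lex_le w u & lex_le v w].

Definition is_lexsegment A : Prop :=
  exists d u v,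
    [/\ mdeg u = d, mdeg v = d & forall w, A w <-> lexseg d u v w].

Definition shadow A : 'X_{1..n} -> Prop :=
  fun w => exists m (i : 'I_n), A m /\ w = (U_(i) + m)%MM.

Definition completely_lexsegment A : Prop :=
  forall t : nat, is_lexsegment (iter t shadow A).

End Lexsegments.

Section Ideals.

Variables (n : nat) (k : fieldType).
Local Notation S := {mpoly k[n]}.
Implicit Types (G I : S -> Prop) (A : 'X_{1..n} -> Prop).

Definition ideal_span G : S -> Prop :=
  fun f => exists s : seq (S * S),
    (forall p, p \in s -> G p.2) /\ f = \sum_(p <- s) p.1 * p.2.

Definition mon_ideal A : S -> Prop :=
  ideal_span (fun f => exists2 m, A m & f = 'X_[m]).

Definition same_ideal I J : Prop := forall f, I f <-> J f.

Definition colon I (g : S) : S -> Prop := fun f => I (f * g).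

Definition generated_by_variables I : Prop :=
  exists V : {set 'I_n},
    same_ideal I (ideal_span (fun f => exists2 j, j \in V & f = 'X_j)).

Definition minimal_mon_generators I (s : seq 'X_{1..n}) : Prop :=
  same_ideal I (mon_ideal (fun m => m \in s)) /\
  forall m, m \in s -> ~ same_ideal I (mon_ideal (fun m' => m' \in rem m s)).

Definition linear_quotients I : Prop :=
  exists s : seq 'X_{1..n},
    minimal_mon_generators I s /\
    forall i, (0 < i < size s)%N ->
      generated_by_variables
        (colon (mon_ideal (fun m => m \in take i s)) 'X_[nth 0%MM s i]).

(* A graded resolution  ... -> F_1 -> F_0 -> I -> 0  by finitely generated
   graded free modules F_i = \bigoplus_a S(- shift i a).  Elements of F_i are
   row vectors, on which the matrices of the differentials act from the right;
   the augmentation F_0 -> I is given by a column of elements of I.  The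
   homogeneity conditions say that these maps have degree 0. *)
Record graded_free_resolution I := GradedFreeResolution {
  rk : nat -> nat;
  shift : forall i, 'I_(rk i) -> int;
  aug : 'cV[S]_(rk 0);
  diff : forall i, 'M[S]_(rk i.+1, rk i);
  aug_homog : forall a m,
    m \in msupp (aug a 0) -> shift a = (mdeg m)%:Z;
  diff_homog : forall i a b m,
    m \in msupp (diff i a b) -> shift a = shift b + (mdeg m)%:Z;
  aug_image : forall f,
    I f <-> exists z : 'rV[S]_(rk 0), f = (z *m aug) 0 0;
  exact_aug : forall z : 'rV[S]_(rk 0),
    z *m aug = 0 <-> exists y, z = y *m diff 0;
  exact_diff : forall i (z : 'rV[S]_(rk i.+1)),
    z *m diff i = 0 <-> exists y, z = y *m diff i.+1
}.

Section Tor.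

Variables (I : S -> Prop) (F : graded_free_resolution I).

(* The complex F (x)_S k, where k = S / (x_1, ..., x_n): its i-th term is
   k^(rk F i), with the a-th basis vector in degree shift a, and its
   differentials are obtained by taking constant terms. *)
Definition diffk i : 'M[k]_(rk F i.+1, rk F i) :=
  map_mx (fun f : S => f@_0%MM) (diff F i).

Definition in_degree i (e : int) (z : 'rV[k]_(rk F i)) : Prop :=
  forall a, z 0 a != 0 -> shift a = e.

Definition cyclek i : 'rV[k]_(rk F i) -> Prop :=
  if i is j.+1 then fun z => z *m diffk j = 0 else fun=> True.

Definition homology_vanishes i (e : int) : Prop :=
  forall z : 'rV[k]_(rk F i), in_degree e z -> cyclek z ->
    exists2 y : 'rV[k]_(rk F i.+1), in_degree e y & z = y *m diffk i.

End Tor.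

(* Tor^S_i(I, k)_e = 0.  By independence of Tor from the resolution, any graded
   free resolution may be used to compute it; one exists since S is
   noetherian. *)
Definition Tor_vanishes I (i : nat) (e : int) : Prop :=
  exists F : graded_free_resolution I, homology_vanishes F i e.

Definition linear_resolution (d : nat) I : Prop :=
  forall (i : nat) (j : int), j != d%:Z -> Tor_vanishes I i (i%:Z + j).

End Ideals.

(* Main.v *)
Require Import Defs.
From mathcomp Require Import all_boot all_order all_algebra.
From mathcomp Require Import zify.
From Stdlib Require Import Classical ClassicalEpsilon.

(** Linear quotients imply a linear resolution: if the rows of a matrix have linear
quotients, the colon (x_t : t in V_i) of the i-th row by the earlier ones yields linear
syzygies g_(i,t) = x_t e_i - ... (t in V_i), which generate all syzygies; ordered by (i, t)
they have linear quotients again, since the colon of g_(i,t) by its predecessors is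
(x_t' : t' < t, t' in V_i). Iterating gives a linear resolution.

Conversely, write x, z for the first and last variables, y for the first variable dividing v,
and let L(u,v) fail to be completely lexsegment. Then some w < v satisfies u < x w/x_i for
every x_i dividing w: otherwise Shad L(u,v) = L(xu, zv), and the next shadows are lexsegments
because x^2 divides xu. If Tor_1 is concentrated in degree d + 1, then the generators y^d and
x z^(d-1) are joined by linear relations inside their lcm, so for some e both y^e z^(d-e) and
x y^(e-1) z^(d-e) lie in L(u,v). Comparison with w forces e = 1, hence v = y z^(d-1) and
u = x u' with u' a monomial in the variables after y. Then the generators prime to x in
decreasing order, followed by those divisible by x in increasing order, have linear
quotients. *)

Set Implicit Arguments.
Unset Strict Implicit.
Unset Printing Implicit Defensive.

Import Order.TTheory GRing.Theory.

(** * Ideals and supports *)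

Section Support.
Local Open Scope ring_scope.
Variables (n : nat) (k : fieldType).
Local Notation S := {mpoly k[n]}.
Implicit Types (f g : S) (m a : 'X_{1..n}) (G : S -> Prop).

Lemma ideal_span0 G : ideal_span G 0.
Proof. by exists [::]; rewrite big_nil. Qed.

Lemma ideal_spanD G f g : ideal_span G f -> ideal_span G g -> ideal_span G (f + g).
Proof.
move=> [s [hs ->]] [t [ht ->]]; exists (s ++ t); rewrite big_cat; split=> // p.
by rewrite mem_cat => /orP[/hs|/ht].
Qed.

Lemma ideal_spanM G f g : G g -> ideal_span G (f * g).
Proof.
by move=> Gg; exists [:: (f, g)]; rewrite big_seq1; split=> // p; rewrite inE => /eqP->.
Qed.

Lemma ideal_span_sum G (I : eqType) (r : seq I) (F : I -> S) :
  (forall i, i \in r -> ideal_span G (F i)) -> ideal_span G (\sum_(i <- r) F i).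
Proof.
move=> h; rewrite big_seq; elim/big_ind: _ => //; first exact: ideal_span0.
exact: ideal_spanD.
Qed.

(** Monomial ideals are handled through predicates on exponents: membership is tested on each
    monomial separately. *)
Definition supp_in (P : 'X_{1..n} -> Prop) f := forall m, m \in msupp f -> P m.

Lemma supp_in_coeff P f m : supp_in P f -> ~ P m -> f@_m = 0.
Proof. by move=> h nP; apply: memN_msupp_eq0; apply/negP => /h. Qed.

Lemma supp_in0 P : supp_in P 0.
Proof. by move=> m; rewrite mcoeff_msupp mcoeff0 eqxx. Qed.

Lemma supp_inD P f g : supp_in P f -> supp_in P g -> supp_in P (f + g).
Proof. by move=> hf hg m /msuppD_le; rewrite mem_cat => /orP[/hf|/hg]. Qed.

Lemma supp_inN P f : supp_in P f -> supp_in P (- f).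
Proof. by move=> hf m; rewrite (perm_mem (msuppN f)) => /hf. Qed.

Lemma supp_in_sum P (I : Type) (r : seq I) (Q : pred I) (F : I -> S) :
  (forall i, Q i -> supp_in P (F i)) -> supp_in P (\sum_(i <- r | Q i) F i).
Proof.
move=> h; elim/big_ind: _ => //; first exact: supp_in0.
exact: supp_inD.
Qed.

Lemma supp_inM P f g : (forall m m', P m -> P (m' + m)%MM) ->
  supp_in P g -> supp_in P (f * g).
Proof.
move=> up h m /msuppM_le /allpairsP[[m1 m2] /= [_ h2 ->]]; exact/up/h.
Qed.

Lemma supp_in_ideal_span G P f : (forall m m', P m -> P (m' + m)%MM) ->
  (forall g, G g -> supp_in P g) -> ideal_span G f -> supp_in P f.
Proof.
move=> up h [s [hs ->]]; rewrite big_seq; apply: supp_in_sum => p /hs /h.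
exact: supp_inM.
Qed.

Lemma mon_idealP (A : 'X_{1..n} -> Prop) f :
  mon_ideal A f <-> supp_in (fun m => exists2 a, A a & (a <= m)%MM) f.
Proof.
split=> [|h].
  apply: supp_in_ideal_span => [m m' [a Aa le]|_ [a Aa ->] m].
    by exists a => //; apply: lepm_trans le _; exact: lem_addl.
  by move/mem_msuppXP=> <-; exists a => //; exact: lepm_refl.
rewrite [f]mpolyE; apply: ideal_span_sum => m /h [a Aa le].
rewrite -[m](submK le) mpolyXD scalerAl; apply: ideal_spanM; by exists a.
Qed.

Lemma mon_idealX (A : 'X_{1..n} -> Prop) m :
  mon_ideal A ('X_[m] : S) <-> exists2 a, A a & (a <= m)%MM.
Proof.
rewrite mon_idealP; split=> [h|h m' /mem_msuppXP <- //].
by apply: h; apply/mem_msuppXP.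
Qed.

Lemma eq_mon_ideal (A B : 'X_{1..n} -> Prop) : (forall m, A m <-> B m) ->
  same_ideal (mon_ideal (k := k) A) (mon_ideal B).
Proof.
move=> AB f; rewrite !mon_idealP.
by split=> h m /h [a /AB Aa le]; exists a.
Qed.

Definition hit (V : {set 'I_n}) m : Prop := exists2 t, t \in V & m t != 0%N.

Lemma hitD V m m' : hit V m -> hit V (m' + m)%MM.
Proof. by move=> [t tV mt]; exists t => //; rewrite mnmDE addn_eq0 negb_and mt orbT. Qed.

Lemma var_idealP (V : {set 'I_n}) f :
  ideal_span (fun g : S => exists2 j, j \in V & g = 'X_j) f <-> supp_in (hit V) f.
Proof.
split=> [|h].
  apply: supp_in_ideal_span => [m m' /hitD //|_ [t tV ->] m /mem_msuppXP <-].
  by exists t => //; rewrite mnm1E eqxx.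
rewrite [f]mpolyE; apply: ideal_span_sum => m /h [t tV]; rewrite -lep1mP => le.
rewrite -[m](submK le) mpolyXD scalerAl; apply: ideal_spanM; by exists t.
Qed.

Lemma supp_in_hitP (V : {set 'I_n}) f :
  supp_in (hit V) f <->
  exists c : 'I_n -> S, (forall t, t \notin V -> c t = 0) /\ f = \sum_t c t * 'X_t.
Proof.
split=> [/var_idealP [s [+ ->]]|[c [c0 ->]]]; last first.
  apply/var_idealP; apply: ideal_span_sum => t _.
  have [tV|/c0->] := boolP (t \in V); last by rewrite mul0r; apply: ideal_span0.
  by apply: ideal_spanM; exists t.
elim: s => [|p s ihs] hs.
  by exists (fun=> 0); rewrite big_nil big1 // => t _; rewrite mul0r.
have [t tV pt] := hs p (mem_head _ _).
have [|c [c0 ec]] := ihs; first by move=> q qs; apply: hs; rewrite inE qs orbT.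
exists (fun t' => (if t' == t then p.1 else 0) + c t'); split=> [t'|].
  by move=> t'V; rewrite c0 // addr0; case: eqP t'V => // ->; rewrite tV.
rewrite big_cons ec; under [RHS]eq_bigr do rewrite mulrDl.
rewrite big_split /=; congr (_ + _).
rewrite (bigD1 t) //= eqxx big1 ?addr0 ?pt // => t' /negPf->; exact: mul0r.
Qed.

End Support.

(** * Shadows of lexsegments *)

Section GradedLex.
Variable n : nat.
Implicit Types (m a b u v w : 'X_{1..n}) (i j l : 'I_n).

(** The order [<=] on exponents compares degrees before it compares lexicographically. *)
Lemma lex_leE a b : mdeg a = mdeg b -> lex_le a b = (a <= b)%O.
Proof. by move=> e; rewrite leEmnm e eqhead_lexiE. Qed.

Lemma lexsegE d u v w : mdeg u = d -> mdeg v = d ->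
  lexseg d u v w <-> mdeg w = d /\ (v <= w <= u)%O.
Proof.
move=> ud vd; split=> [[wd]|[wd /andP[]]].
  by rewrite !lex_leE ?ud ?vd // => wu vw; rewrite vw wu.
by split; rewrite ?lex_leE ?ud ?vd.
Qed.

Lemma lem_mdeg_eq a b : (a <= b)%MM -> mdeg a = mdeg b -> a = b.
Proof.
move=> le e; have /eqP := mdegD (b - a) a.
by rewrite submK // e -[X in X == _]add0n eqn_add2r eq_sym mdeg_eq0 => /eqP z;
  rewrite -(submK le) z add0m.
Qed.

Lemma lt_at a b i : mdeg a = mdeg b -> (forall j : 'I_n, j < i -> a j = b j) ->
  a i < b i -> (a < b)%O.
Proof. by move=> e h hi; apply/(ltmcP e); exists i. Qed.

Lemma leU i j m : i <= j -> ((U_(j) + m)%MM <= (U_(i) + m)%MM)%O.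
Proof.
rewrite lemc_add2l leq_eqVlt => /orP[/eqP/val_inj-> //|ij]; apply: ltW.
by apply: (@lt_at _ _ i) => [|k ki|]; rewrite ?mdeg1 // !mnm1E -!val_eqE /=; lia.
Qed.

Lemma le_zero_prefix p a b : mdeg a = mdeg b -> (a <= b)%O ->
  (forall j : 'I_n, j < p -> b j = 0) -> forall j : 'I_n, j < p -> a j = 0.
Proof.
move=> e; rewrite le_eqVlt => /orP[/eqP-> //|/(ltmcP e)[i eq lt] b0 j jp].
have [ij|ji] := ltnP j i; first by rewrite eq // b0.
by move: lt; rewrite b0 //; exact: leq_ltn_trans jp.
Qed.

Lemma mdeg_neq0 m : mdeg m != 0 -> exists i, m i != 0.
Proof.
move=> m0; apply/existsP; apply: contraNT m0 => /existsPn h; rewrite mdeg_eq0.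
by apply/eqP/mnmP => i; rewrite mnm0E; apply/eqP; have := h i; rewrite negbK.
Qed.

Lemma subUK m i : m i != 0 -> (U_(i) + (m - U_(i)))%MM = m.
Proof. by rewrite -lep1mP => le; rewrite addmC submK. Qed.

Lemma mdeg_subU m i d : m i != 0 -> mdeg m = d.+1 -> mdeg (m - U_(i)) = d.
Proof. by move=> /subUK <-; rewrite mdegD mdeg1 addmC addmK => -[]. Qed.

Lemma lt_ex_gt a b i : mdeg a = mdeg b -> (forall j : 'I_n, j < i -> a j = b j) ->
  a i < b i -> exists2 j : 'I_n, i < j & b j < a j.
Proof.
move=> e h hi; apply: NNPP => no; have ab : a = b.
  apply: lem_mdeg_eq => //; apply/mnm_lepP => j; case: (ltngtP j i) => [/h->//|ij|/val_inj->].
    by rewrite leqNgt; apply/negP => lt; apply: no; exists j.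
  exact: ltnW.
by rewrite ab ltnn in hi.
Qed.

End GradedLex.

Section Lexsegment.
Variable n : nat.
Implicit Types (m a b u v w : 'X_{1..n.+1}) (i j l : 'I_n.+1).
Local Notation x0 := (@ord0 n).
Local Notation xN := (@ord_max n).

Lemma lt_at0 a b : mdeg a = mdeg b -> a x0 < b x0 -> (a < b)%O.
Proof. by move=> e; apply: lt_at. Qed.

Lemma le_zero0 a b : mdeg a = mdeg b -> (a <= b)%O -> b x0 = 0 -> a x0 = 0.
Proof.
move=> e le b0; apply: (le_zero_prefix (p := 1) e le) => // j.
by rewrite ltnS leqn0 => /eqP j0; rewrite (_ : j = x0) //; exact: val_inj.
Qed.

Lemma le_max_pow m d : mdeg m = d -> ((U_(xN) *+ d)%MM <= m)%O.
Proof.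
move=> md; rewrite leNgt; apply/negP => lt.
have e : mdeg m = mdeg (U_(xN) *+ d) by rewrite mdegMn mdeg1 mul1n.
have /(ltmcP e)[k eq hk] := lt; have [j kj] := lt_ex_gt e eq hk.
move: hk; rewrite !mulmnE !mnm1E; case: eqP kj => [<-|]; last lia.
by have := ltn_ord j; rewrite ltnS /= => jn nj; lia.
Qed.

(** Take the last variable x_p dividing m. If m/x_p < v with first difference at k, then k < p would
    give m < zv, and k >= p would leave a variable of m after x_p. *)
Lemma le_divide_last m v d : mdeg v = d -> mdeg m = d.+1 ->
  ((U_(xN) + v)%MM <= m)%O -> exists2 i, m i != 0 & (v <= (m - U_(i))%MM)%O.
Proof.
move=> vd md le; have [|i0 m0] := @mdeg_neq0 _ m; first by rewrite md.
pose p := [arg max_(p > i0 | m p != 0) (p : nat)].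
have [mp pmax] : m p != 0 /\ forall i, m i != 0 -> i <= p.
  by rewrite /p; case: arg_maxnP.
exists p => //; rewrite leNgt; apply/negP => lt.
have e : mdeg (m - U_(p)) = mdeg v by rewrite (mdeg_subU mp md).
have /(ltmcP e)[k eq hk] := lt; have [pk|kp] := leqP p k.
  have [j kj] := lt_ex_gt e eq hk; rewrite mnmBE => h.
  by have := pmax j; lia.
move: le; rewrite leNgt => /negP; apply; have pN := ltn_ord p.
apply: (@lt_at _ _ _ k); first by rewrite mdegD mdeg1 md vd.
  move=> j jk; rewrite mnmDE mnm1E -eq // mnmBE mnm1E -!val_eqE /=; lia.
by move: hk; rewrite mnmDE mnmBE !mnm1E -!val_eqE /=; lia.
Qed.

Section Shadow.
Hypothesis n0 : 0 < n.

(* For x_1 | u and x_1 not dividing v, this says that the shadow of L(u,v) is a lexsegment. *)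
Definition exchangeable d u v := forall w, mdeg w = d -> (w < v)%O ->
  exists2 i, w i != 0 & ((U_(x0) + (w - U_(i)))%MM <= u)%O.

(** Let m lie between zv and xu. If x does not divide m, divide m by its last variable. Otherwise
    m/x <= u; if m/x < v, the exchange supplies x_i with m/x_i <= u, and m/x_i >= v since x still
    divides it. *)
Lemma shadow_lexseg d u v : mdeg u = d -> mdeg v = d -> u x0 != 0 -> v x0 = 0 ->
  exchangeable d u v -> forall m,
  shadow (lexseg d u v) m <-> lexseg d.+1 (U_(x0) + u) (U_(xN) + v) m.
Proof.
move=> ud vd u0 v0 ex m.
have ud' : mdeg (U_(x0) + u) = d.+1 by rewrite mdegD mdeg1 ud.
have vd' : mdeg (U_(xN) + v) = d.+1 by rewrite mdegD mdeg1 vd.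
rewrite lexsegE //; split=> [[w [i [/(lexsegE _ ud vd)[wd /andP[vw wu]] ->]]]|].
  rewrite mdegD mdeg1 wd; split=> //; apply/andP; split.
    by apply: le_trans (@leU _ i xN v (leq_ord i)) _; rewrite lemc_add2r.
  by apply: le_trans (@leU _ x0 i w (leq0n i)) _; rewrite lemc_add2r.
move=> [md /andP[vm mu]].
suff [i mi /andP[vi iu]] : exists2 i, m i != 0 & (v <= (m - U_(i))%MM <= u)%O.
  exists (m - U_(i))%MM, i; split; last by rewrite subUK.
  by apply/lexsegE => //; rewrite (mdeg_subU mi md) vi iu.
have [m0|m0] := eqVneq (m x0) 0.
  have [i mi vi] := le_divide_last vd md vm; exists i => //; rewrite vi.
  by apply: ltW; apply: lt_at0; rewrite ?ud ?(mdeg_subU mi md) // mnmBE m0 lt0n.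
have wd := mdeg_subU m0 md; set w := (m - U_(x0))%MM in wd.
have wu : (w <= u)%O by move: mu; rewrite -(subUK m0) lemc_add2r.
have [vw|wv] := leP v w; first by exists x0; rewrite // vw.
have [i wi iu] := ex w wd wv.
have w0 : w x0 = 0 by apply: le_zero0 (ltW wv) v0; rewrite wd vd.
have ni : i != x0 by apply: contraNneq wi => ->; rewrite w0.
have em : (m - U_(i))%MM = (U_(x0) + (w - U_(i)))%MM.
  by rewrite -{1}(subUK m0) -/w -{1}(subUK wi) addmA [(_ + U_(i))%MM]addmC -addmA addmC addmK.
have mi : m i != 0.
  by rewrite -(subUK m0) -/w mnmDE addn_eq0 negb_and wi orbT.
exists i => //; rewrite em iu andbT ltW //; apply: lt_at0.
  by rewrite vd -em (mdeg_subU mi md).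
by rewrite v0 mnmDE mnm1E eqxx.
Qed.

Lemma shadow_ext (A B : 'X_{1..n.+1} -> Prop) : (forall m, A m <-> B m) ->
  forall m, shadow A m <-> shadow B m.
Proof. by move=> AB m; split=> -[w [i [/AB Aw ->]]]; exists w, i. Qed.

Lemma iter_shadow_ext t (A B : 'X_{1..n.+1} -> Prop) : (forall m, A m <-> B m) ->
  forall m, iter t (@shadow n.+1) A m <-> iter t (@shadow n.+1) B m.
Proof. by move=> AB; elim: t => //= t; exact: shadow_ext. Qed.

(** The pair (xu, zv) is exchangeable again: a monomial w < zv is prime to x, so w/x_i < u for any
    x_i dividing w. *)
Lemma exchangeable_completely_lexsegment d u v : mdeg u = d -> mdeg v = d ->
  u x0 != 0 -> v x0 = 0 -> exchangeable d u v -> completely_lexsegment (lexseg d u v).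
Proof.
move=> ud vd u0 v0 ex t; elim: t d u v ud vd u0 v0 ex => [|t iht] d u v ud vd u0 v0 ex.
  by exists d, u, v.
have v0' : (U_(xN) + v)%MM x0 = 0.
  by rewrite mnmDE mnm1E v0 -val_eqE /=; lia.
have ud' : mdeg (U_(x0) + u) = d.+1 by rewrite mdegD mdeg1 ud.
have vd' : mdeg (U_(xN) + v) = d.+1 by rewrite mdegD mdeg1 vd.
have [|w wd wv|d' [u' [v' [u'd v'd h]]]] := iht d.+1 (U_(x0) + u)%MM (U_(xN) + v)%MM ud' vd' _ v0'.
- by rewrite mnmDE mnm1E eqxx.
- have [|i wi] := @mdeg_neq0 _ w; first by rewrite wd.
  have w0 : w x0 = 0 by apply: le_zero0 (ltW wv) v0'; rewrite wd vd'.
  exists i => //; rewrite lemc_add2r ltW //; apply: lt_at0.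
    by rewrite (mdeg_subU wi wd).
  by rewrite mnmBE w0 lt0n.
exists d', u', v'; split=> // w; rewrite -h iterSr; apply: iter_shadow_ext => m.
exact: shadow_lexseg.
Qed.

End Shadow.
End Lexsegment.

(** * Linear quotients give linear resolutions *)

Section LinearQuotientMatrices.
Local Open Scope ring_scope.
Variables (n : nat) (k : fieldType).
Local Notation S := {mpoly k[n]}.

(** Allows the coefficients of a relation between homogeneous rows to be cut down to a single
    degree. *)
Lemma pihomog_mul_homog (e d : nat) (p q : S) : q \is d.-homog ->
  pihomog mdeg (e + d) (p * q) = pihomog mdeg e p * q.
Proof.
move=> qd; have pK : (msize p <= (msize p + e).+1)%N by lia.
have eK : (e < (msize p + e).+1)%N by lia.
rewrite {1}(pihomog_partitionE pK) mulr_suml raddf_sum /=.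
rewrite (bigD1 (Ordinal eK)) //= big1 ?addr0 => [|e' ne].
  by rewrite pihomog_dE //; apply: dhomogM => //; exact: pihomogP.
apply: (@pihomog_ne0 _ _ mdeg (e' + d)%N); last by apply: dhomogM => //; exact: pihomogP.
by rewrite eqn_add2r.
Qed.

Definition support_below r (rank : 'I_r -> nat) N (z : 'rV[S]_r) :=
  forall j, z 0 j != 0 -> (rank j < N)%N.

(* The order of the rows is given by [rank] rather than by their indices, so that the
   syzygies g_(i,t) need not be enumerated lexicographically. *)
Record lin_quot_mx r c (A : 'M[S]_(r, c)) (rank : 'I_r -> nat)
    (V : 'I_r -> {set 'I_n}) : Prop := LinQuotMx {
  rank_inj : injective rank;
  row_colon : forall i f,
    (exists2 z, support_below rank (rank i) z & f *: row i A = z *m A)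
    <-> supp_in (hit (V i)) f }.

Definition homog_mx d r c (A : 'M[S]_(r, c)) :=
  forall i j, A i j \is d.-homog.

Section Syzygies.

Variables (d r c : nat) (A : 'M[S]_(r, c)) (rank : 'I_r -> nat).
Variable V : 'I_r -> {set 'I_n}.
Hypotheses (Ahom : homog_mx d A) (Alq : lin_quot_mx A rank V).

(** As x_t lies in the colon ideal, x_t times row [i] is a combination of earlier rows; by
    homogeneity of the rows, the linear parts of the coefficients suffice. *)
Lemma linear_syzygy i t : t \in V i ->
  exists g : 'rV[S]_r, [/\ g *m A = 0, g 0 i = 'X_t,
    forall j, g 0 j != 0 -> j != i -> (rank j < rank i)%N & homog_mx 1 g].
Proof.
move=> tV; have : supp_in (hit (V i)) ('X_t : S).
  by move=> m /mem_msuppXP <-; exists t => //; rewrite mnm1E eqxx.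
move/(row_colon Alq) => [z zlt ez].
pose z1 := \row_j pihomog mdeg 1 (z 0 j).
have X1 : ('X_t : S) \is 1.-homog by rewrite dhomogX /= mdeg1.
have ez1 : 'X_t *: row i A = z1 *m A.
  apply/rowP => j; have /rowP/(_ j) := ez; rewrite !mxE => e.
  have hX : 'X_t * A i j \is (1 + d).-homog by apply: dhomogM; last exact: Ahom.
  rewrite -[LHS](pihomog_dE hX) e raddf_sum; apply: eq_bigr => l _; rewrite mxE.
  exact: pihomog_mul_homog.
have z1i : z1 0 i = 0.
  rewrite mxE; have [->|/zlt] := eqVneq (z 0 i) 0; first by rewrite raddf0.
  by rewrite ltnn.
exists ('X_t *: delta_mx 0 i - z1); split.
- by rewrite mulmxBl -scalemxAl -rowE ez1 subrr.
- by rewrite mxE [X in _ + X]mxE z1i !mxE !eqxx mulr1 subr0.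
- move=> j + ji; rewrite !mxE (negPf ji) mulr0 sub0r oppr_eq0 => nz.
  by apply: zlt; apply: contraNneq nz => ->; rewrite raddf0.
move=> a j; rewrite !mxE; apply: rpredB; last exact: pihomogP.
by case: (_ && _); rewrite ?mulr1 ?mulr0 ?rpred0.
Qed.

Lemma syzygy_matrix : exists r' (B : 'M[S]_(r', r)) (rank' : 'I_r' -> nat) V',
  [/\ forall z : 'rV[S]_r, z *m A = 0 <-> exists y, z = y *m B,
      homog_mx 1 B & lin_quot_mx B rank' V'].
Proof.
(* A vector is chosen for every pair (i, t), but constrained only when t lies in [V i]; only those
   pairs index the rows of [B]. *)
have /fin_all_exists [G HG] (p : 'I_r * 'I_n) : exists g : 'rV[S]_r,
    p.2 \in V p.1 -> [/\ g *m A = 0, g 0 p.1 = 'X_p.2,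
      forall j, g 0 j != 0 -> j != p.1 -> (rank j < rank p.1)%N & homog_mx 1 g].
  have [/linear_syzygy[g Hg]|_] := boolP (p.2 \in V p.1); last by exists 0.
  by exists g.
pose P := [set p : 'I_r * 'I_n | p.2 \in V p.1].
pose ev (a : 'I_#|P|) : 'I_r * 'I_n := enum_val a.
have evP a : (ev a).2 \in V (ev a).1 by have := enum_valP a; rewrite inE.
pose B : 'M[S]_(#|P|, r) := \matrix_a G (ev a).
have HB a := HG _ (evP a).
have BA (y : 'rV[S]_#|P|) : y *m B *m A = 0.
  rewrite -mulmxA (_ : B *m A = 0) ?mulmx0 //.
  by apply/row_matrixP => a; rewrite row_mul rowK row0; case: (HB a).
pose comb i (f : 'I_n -> S) : 'rV[S]_#|P| :=
  \row_a (if (ev a).1 == i then f (ev a).2 else 0).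
have combB i (f : 'I_n -> S) : (forall t, t \notin V i -> f t = 0) ->
    comb i f *m B = \sum_t f t *: G (i, t).
  move=> f0; rewrite mulmx_sum_row.
  transitivity (\sum_(p in P) (if p.1 == i then f p.2 else 0) *: G p).
    by rewrite [RHS]big_enum_val; apply: eq_bigr => a _; rewrite rowK mxE.
  transitivity (\sum_p (if p.1 == i then f p.2 else 0) *: G p).
    rewrite big_mkcond; apply: eq_bigr => -[i' t] _; rewrite inE /=.
    by case: ifP => // /negbT tV; case: eqP tV => [-> /f0->|]; rewrite scale0r.
  transitivity (\sum_i' \sum_t (if i' == i then f t else 0) *: G (i', t)).
    by rewrite pair_bigA; apply: eq_bigr => -[].
  rewrite (bigD1 i) //= [X in _ + X]big1 ?addr0 => [|i' /negPf ne].
    by apply: eq_bigr => t _; rewrite eqxx.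
  by rewrite big1 // => t _; rewrite ne scale0r.
have Gii i (f : 'I_n -> S) : (forall t, t \notin V i -> f t = 0) ->
    (\sum_t f t *: G (i, t)) 0 i = \sum_t f t * 'X_t.
  move=> f0; rewrite summxE; apply: eq_bigr => t _; rewrite mxE.
  have [tV|/f0->] := boolP (t \in V i); last by rewrite !mul0r.
  by case: (HG (i, t) tV) => _ ->.
have Gij i (f : 'I_n -> S) j : (forall t, t \notin V i -> f t = 0) -> j != i ->
    (\sum_t f t *: G (i, t)) 0 j != 0 -> (rank j < rank i)%N.
  move=> f0 ji; rewrite summxE ltnNge; apply: contraNN => le.
  rewrite big1 // => t _; rewrite mxE.
  have [tV|/f0->] := boolP (t \in V i); last by rewrite mul0r.
  have [_ _ /(_ j) + _] := HG (i, t) tV; have [->|_] := eqVneq; first by rewrite mulr0.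
  by move=> /(_ isT ji) /=; lia.
(* Elimination of the top row: the coefficient of a syzygy there lies in the colon ideal of that
   row, so a combination of the g_(i,t) cancels it and lowers the bound [N]. *)
have kerA N z : support_below rank N z -> z *m A = 0 ->
    exists2 y, z = y *m B & forall a, y 0 a != 0 -> (rank (ev a).1 < N)%N.
  elim: N z => [|N ihN] z zN zA.
    exists 0 => [|a]; last by rewrite mxE eqxx.
    rewrite mul0mx; apply/rowP => j; rewrite mxE; apply/eqP.
    by apply: contraT => /zN.
  have [i /eqP iN|noi] := pickP (fun i => rank i == N); last first.
    have [|y -> yN] := ihN z _ zA; last by exists y => // a /yN; exact: leqW.
    by move=> j /zN; rewrite ltnS leq_eqVlt noi.
  have [f [f0 ef]] : exists f : 'I_n -> S,
      (forall t, t \notin V i -> f t = 0) /\ z 0 i = \sum_t f t * 'X_t.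
    apply/supp_in_hitP/(row_colon Alq).
    exists (z 0 i *: delta_mx 0 i - z); last by rewrite mulmxBl zA subr0 -scalemxAl -rowE.
    move=> j; rewrite !mxE eqxx /=; have [->|ji] := eqVneq j i.
      by rewrite mulr1 subrr eqxx.
    rewrite mulr0 sub0r oppr_eq0 => /zN; rewrite ltnS leq_eqVlt -iN (inj_eq (rank_inj Alq)).
    by rewrite (negPf ji).
  have [||y ey yN] := ihN (z - comb i f *m B).
  - move=> j; rewrite combB //; have [->|ji] := eqVneq j i.
      by rewrite mxE [X in _ + X]mxE Gii // -ef subrr eqxx.
    rewrite mxE [X in _ + X]mxE => nz.
    have [z0|/zN] := eqVneq (z 0 j) 0.
      by move: nz; rewrite z0 sub0r oppr_eq0 => /Gij; rewrite iN; apply.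
    by rewrite ltnS leq_eqVlt -iN (inj_eq (rank_inj Alq)) (negPf ji).
  - by rewrite mulmxBl BA zA subr0.
  exists (y + comb i f) => [|a]; first by rewrite mulmxDl -ey subrK.
  rewrite !mxE; have [->|_] := eqVneq (ev a).1 i; first by rewrite iN ltnS.
  by rewrite addr0 => /yN; exact: leqW.
(* Since t < n, this number encodes the lexicographic order on the pairs (rank of i, t). *)
pose rank' a := (rank (ev a).1 * n + (ev a).2)%N.
pose V' a := [set t in V (ev a).1 | (t < (ev a).2)%N].
have rank'P a b : (rank' b < rank' a)%N =
    (rank (ev b).1 < rank (ev a).1)%N ||
    ((ev b).1 == (ev a).1) && ((ev b).2 < (ev a).2)%N.
  rewrite /rank' -(inj_eq (rank_inj Alq)).
  have := ltn_ord (ev a).2; have := ltn_ord (ev b).2.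
  move: (rank _) (rank _) => x y; case: (ltngtP x y) => [lt|gt|->] /= h1 h2; last by rewrite ltn_add2l.
    by apply/idP; nia.
  by apply/idP; nia.
exists #|P|, B, rank', V'; split.
- move=> z; split=> [zA|[y ->]]; last exact: BA.
  have [|y -> _] := @kerA (\max_j (rank j).+1) z _ zA; last by exists y.
  by move=> j _; exact: (leq_bigmax j).
- by move=> a j; rewrite mxE; case: (HB a) => _ _ _; apply.
split=> [a b|a f].
  rewrite /rank' => e; apply: enum_val_inj; rewrite -/(ev a) -/(ev b).
  have := ltn_ord (ev a).2; have := ltn_ord (ev b).2.
  case: (ev a) (ev b) e => [i s] [j t] /= e h1 h2.
  have [e1 e2] : rank i = rank j /\ s = t :> nat.
    by have [lt|lt|eq] := ltngtP (rank i) (rank j); nia.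
  by congr (_, _); [exact: (rank_inj Alq) | exact: val_inj].
(* Compare coordinates at i: the syzygies of earlier rows vanish there and g_(i,s) has entry x_s, so
   f x_t lies in (x_s : s < t, s in V_i). As x_t is not among these variables, it cancels. *)
split=> [[z zlt ez]|].
  have : supp_in (hit (V' a)) (f * 'X_(ev a).2).
    have /rowP/(_ (ev a).1) := ez; rewrite !mxE; have [_ -> _ _] := HB a; move=> ->.
    apply: supp_in_sum => b _; rewrite mxE.
    have [->|/zlt] := eqVneq (z 0 b) 0; first by rewrite mul0r; exact: supp_in0.
    have [_ eb hb _] := HB b.
    rewrite rank'P => /orP[lt|/andP[/eqP e lt]].
      have [->|/hb] := eqVneq (G (ev b) 0 (ev a).1) 0.
        by rewrite mulr0; exact: supp_in0.
      by have [e|_ /(_ isT)] := eqVneq; [move: lt; rewrite e|]; lia.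
    apply: supp_inM => [m m'|]; first exact: hitD.
    rewrite -e eb => m /mem_msuppXP <-; exists (ev b).2; last by rewrite mnm1E eqxx.
    by rewrite inE lt -e evP.
  move=> h m mf; have [|t] := h (m + U_((ev a).2))%MM.
    by rewrite mcoeff_msupp addmC mcoeffMX -mcoeff_msupp.
  rewrite inE => /andP[tV lt]; rewrite mnmDE mnm1E => nz; exists t; first by rewrite inE tV.
  by move: nz lt; have [->|_] := eqVneq (ev a).2 t; rewrite ?ltnn ?addn0.
(* Conversely, write f as the sum of the h_s x_s. Subtracting the h_s x_t g_(i,s) from f g_(i,t)
   kills the coordinate at i, and [kerA] expresses the rest by syzygies of earlier rows. *)
case/supp_in_hitP => h [h0 ef].
have h0' t : t \notin V (ev a).1 -> h t * 'X_(ev a).2 = 0.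
  by move=> tV; rewrite h0 ?mul0r // inE negb_and tV.
have [Ga Gaa Gaj _] := HB a.
pose w := f *: G (ev a) - \sum_t (h t * 'X_(ev a).2) *: G ((ev a).1, t).
have [||y ey yN] := @kerA (rank (ev a).1) w.
- move=> j; rewrite !mxE; have [->|ji] := eqVneq j (ev a).1.
    rewrite Gii // Gaa ef mulr_suml; apply: contraR => _; rewrite subr_eq0.
    by apply/eqP/eq_bigr => t _; rewrite mulrAC.
  have [->|/Gaj/(_ ji)//] := eqVneq (G (ev a) 0 j) 0.
  by rewrite mulr0 sub0r oppr_eq0; exact: Gij.
- by rewrite mulmxBl -scalemxAl Ga scaler0 -combB // BA subr0.
exists (y + comb (ev a).1 (fun t => h t * 'X_(ev a).2)).
  move=> b; rewrite rank'P !mxE; have [e|_] := eqVneq (ev b).1 (ev a).1; last by rewrite addr0 => /yN->.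
  have [|] := boolP ((ev b).2 < (ev a).2)%N; first by rewrite orbT.
  move=> nlt; rewrite h0 ?mul0r ?addr0 => [/yN->//|]; by rewrite inE negb_and nlt orbT.
by rewrite mulmxDl -ey combB // rowK subrK.
Qed.

End Syzygies.

(** What the syzygy construction preserves, bundled for iteration. The degree is a field because it
    is d for the generators and 1 for every differential. *)
Record lin_quot_stage (c : nat) := LinQuotStage {
  stage_rk : nat;
  stage_mx : 'M[S]_(stage_rk, c);
  stage_deg : nat;
  stage_homog : homog_mx stage_deg stage_mx;
  stage_lin_quot : exists rank V, lin_quot_mx stage_mx rank V }.

Lemma next_stage_exists c (s : lin_quot_stage c) :
  exists s' : lin_quot_stage (stage_rk s), stage_deg s' = 1 /\
    forall z : 'rV[S]_(stage_rk s),
      z *m stage_mx s = 0 <-> exists y, z = y *m stage_mx s'.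
Proof.
have [rank [V Alq]] := stage_lin_quot s.
have [r' [B [rank' [V' [ex Bhom Blq]]]]] := syzygy_matrix (@stage_homog _ s) Alq.
have Blq' : exists rank V, lin_quot_mx B rank V by exists rank', V'.
by exists (LinQuotStage Bhom Blq').
Qed.

Definition next_stage c (s : lin_quot_stage c) :=
  proj1_sig (constructive_indefinite_description _ (next_stage_exists s)).

Lemma next_stageP c (s : lin_quot_stage c) : stage_deg (next_stage s) = 1 /\
  forall z : 'rV[S]_(stage_rk s),
    z *m stage_mx s = 0 <-> exists y, z = y *m stage_mx (next_stage s).
Proof. by rewrite /next_stage; case: constructive_indefinite_description. Qed.

Fixpoint stages c (s : lin_quot_stage c) i : {c' & lin_quot_stage c'} :=
  if i is j.+1 then Tagged _ (next_stage (tagged (stages s j))) else Tagged _ s.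

(** The i-th free module is generated in the single degree [stage_deg s + i], so after tensoring
    with k every chain of another degree is zero. *)
Lemma linear_resolution_of_stage (I : S -> Prop) (s : lin_quot_stage 1) :
  (forall f, I f <-> exists z : 'rV[S]_(stage_rk s), f = (z *m stage_mx s) 0 0) ->
  linear_resolution (stage_deg s) I.
Proof.
move=> imI i j jd.
pose F i := tagged (stages s i).
have augH a m : m \in msupp (stage_mx s a 0) ->
    (stage_deg s + 0)%N%:Z = (mdeg m)%:Z.
  by move=> ma; have /dhomogP h := stage_homog a 0; rewrite addn0 -(h m ma).
have diffH l a b m : m \in msupp (stage_mx (F l.+1) a b) ->
    (stage_deg s + l.+1)%N%:Z = (stage_deg s + l)%N%:Z + (mdeg m)%:Z.
  have [e _] := next_stageP (F l); have := @stage_homog _ (F l.+1) a b.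
  by rewrite e => /dhomogP h /h /= ->; rewrite addnS -addn1 PoszD.
have augE (z : 'rV[S]_(stage_rk s)) :
    z *m stage_mx s = 0 <-> exists y, z = y *m stage_mx (F 1).
  by have [_] := next_stageP (F 0).
have diffE l (z : 'rV[S]_(stage_rk (F l.+1))) :
    z *m stage_mx (F l.+1) = 0 <-> exists y, z = y *m stage_mx (F l.+2).
  by have [_] := next_stageP (F l.+1).
exists (@GradedFreeResolution n k I (fun l => stage_rk (F l))
  (fun l _ => (stage_deg s + l)%N%:Z) (stage_mx s) (fun l => stage_mx (F l.+1))
  augH diffH imI augE diffE) => z zdeg _.
exists 0; first by move=> a; rewrite mxE eqxx.
rewrite mul0mx; apply/rowP => a; rewrite mxE; apply/eqP/contraT => /zdeg /=.
by rewrite PoszD addrC => /addrI e; rewrite e eqxx in jd.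
Qed.

End LinearQuotientMatrices.

(** * Monomial generators as a matrix with linear quotients *)

Section LinearQuotients.
Local Open Scope ring_scope.
Variables (n : nat) (k : fieldType).
Local Notation S := {mpoly k[n]}.
Implicit Types (s : seq 'X_{1..n}) (A : 'X_{1..n} -> Prop).

Definition mon_col s : 'cV[S]_(size s) := \col_i 'X_[nth 0%MM s i].

Lemma mon_ideal_takeP s i f : mon_ideal (k := k) (fun m => m \in take i s) f <->
  exists2 z : 'rV[S]_(size s),
    support_below (fun j => j : nat) i z & f = (z *m mon_col s) 0 0.
Proof.
split=> [[t [+ ->]]|[z zi ->]]; last first.
  rewrite mxE; apply: ideal_span_sum => j _; rewrite mxE.
  have [->|/zi ji] := eqVneq (z 0 j) 0; first by rewrite mul0r; exact: ideal_span0.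
  apply: ideal_spanM; exists (nth 0%MM s j) => //.
  by rewrite -(nth_take _ ji) mem_nth // size_take_min leq_min ji ltn_ord.
elim: t => [|p t iht] ht.
  exists 0 => [j|]; first by rewrite mxE eqxx.
  by rewrite big_nil mul0mx mxE.
have [|z zi ez] := iht; first by move=> q qt; apply: ht; rewrite inE qt orbT.
have [m ms ep] := ht p (mem_head _ _).
have ms' : m \in s by exact: mem_take ms.
have js : (index m s < size s)%N by rewrite index_mem.
exists (p.1 *: delta_mx 0 (Ordinal js) + z) => [j|].
  rewrite !mxE eqxx /=; have [->|_] := eqVneq j (Ordinal js); first by rewrite -in_take.
  by rewrite mulr0 add0r => /zi.
by rewrite big_cons ez mulmxDl -scalemxAl -rowE !mxE /= nth_index // ep.
Qed.

(** Some a in A divides m, and some m2 in [s] divides a. If m2 differed from m, then m could be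
    dropped from [s]; hence m = a. *)
Lemma minimal_generator_degree A d s m : (forall a, A a -> mdeg a = d) ->
  minimal_mon_generators (mon_ideal (k := k) A) s -> m \in s -> mdeg m = d.
Proof.
move=> Ad [sA smin] ms.
have [a Aa am] : exists2 a, A a & (a <= m)%MM.
  apply/(mon_idealX k)/sA/mon_idealX; exists m => //; exact: lepm_refl.
have [m2 m2s m2a] : exists2 m2, m2 \in s & (m2 <= a)%MM.
  apply/(mon_idealX k)/sA/mon_idealX; exists a => //; exact: lepm_refl.
have [e|ne] := eqVneq m2 m.
  rewrite -(Ad a Aa); congr mdeg; apply/mnmP => i; apply/eqP.
  by rewrite eqn_leq (mnm_lepP am) -e (mnm_lepP m2a).
have in_rem c : c \in s -> c != m -> c \in rem m s.
  by rewrite (perm_mem (perm_to_rem ms)) inE => /orP[/eqP->|//]; rewrite eqxx.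
case: (smin m ms) => f; rewrite sA !mon_idealP; split=> h b /h [c cs cb]; last first.
  by exists c => //; exact: mem_rem cs.
have [ec|nc] := eqVneq c m; last by exists c => //; exact: in_rem.
exists m2; first exact: in_rem.
by apply: lepm_trans m2a _; apply: lepm_trans am _; rewrite -ec; exact: cb.
Qed.

Lemma linear_quotients_linear_resolution A d : (forall a, A a -> mdeg a = d) ->
  linear_quotients (mon_ideal (k := k) A) -> linear_resolution d (mon_ideal (k := k) A).
Proof.
move=> Ad [s [smin slq]].
have Shom : homog_mx d (mon_col s).
  move=> i j; rewrite mxE dhomogX; apply/eqP.
  by apply: (minimal_generator_degree Ad smin); exact: mem_nth.
have /fin_all_exists [V hV] (i : 'I_(size s)) : exists V : {set 'I_n}, forall f : S,
    mon_ideal (fun m => m \in take i s) (f * 'X_[nth 0%MM s i]) <-> supp_in (hit V) f.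
  have [i0|i0] := posnP i; last first.
    have [|V hV] := slq i; first by rewrite i0 ltn_ord.
    by exists V => f; rewrite -var_idealP; exact: hV.
  (* [linear_quotients] starts at i = 1; for i = 0 the colon of the zero ideal by a monomial is
     zero, generated by no variables. *)
  exists set0 => f; rewrite mon_idealP i0 take0; split=> h m.
    move=> mf; have [|//] := h (nth 0%MM s 0 + m)%MM.
    by rewrite mcoeff_msupp mcoeffMX -mcoeff_msupp.
  rewrite (_ : f = 0) ?mul0r ?msupp0 //.
  apply/eqP; rewrite -msupp_eq0; case E: (msupp f) => [|m' t] //.
  by have [|t'] := h m'; rewrite ?E ?mem_head ?inE.
have Slq : exists rank V, lin_quot_mx (mon_col s) rank V.
  exists (fun j => j : nat), V; split=> [|i f]; first exact: val_inj.
  rewrite -hV mon_ideal_takeP; split=> -[z zi ez]; exists z => //.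
    by rewrite -ez !mxE.
  by apply/rowP => j; rewrite ord1 -ez !mxE.
apply: (@linear_resolution_of_stage n k _ (LinQuotStage Shom Slq)) => f /=.
have [-> _] := smin; rewrite -[X in mon_ideal (fun m => m \in X)](take_size s).
rewrite mon_ideal_takeP; split=> -[z]; first by move=> _ ->; exists z.
by move=> ->; exists z => // j _.
Qed.

End LinearQuotients.

(** * A non-vanishing criterion for Tor_1 *)

Section TorObstruction.
Local Open Scope ring_scope.
Variables (n : nat) (k : fieldType).
Local Notation S := {mpoly k[n]}.
Implicit Types (P Q : pred 'X_{1..n}) (m : 'X_{1..n}) (f : S).

Definition mrestrict P f : S := \sum_(m <- msupp f | P m) f@_m *: 'X_[m].

Lemma mcoeff_mrestrict P f m : (mrestrict P f)@_m = if P m then f@_m else 0.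
Proof.
rewrite raddf_sum /=; have [mf|mf] := boolP (m \in msupp f); last first.
  rewrite (memN_msupp_eq0 mf) if_same big_seq_cond big1 // => m' /andP[m'f _].
  rewrite mcoeffZ mcoeffX; case: eqP m'f mf => [->|_ _ _]; last by rewrite mulr0.
  by move=> ->.
have h m' : m' != m -> (f@_m' *: 'X_[m'])@_m = 0 :> k.
  by move=> /negPf ne; rewrite mcoeffZ mcoeffX ne mulr0.
rewrite big_mkcond (bigD1_seq m) ?msupp_uniq //= big1 ?addr0 => [|m' /h ->]; last by case: ifP.
by rewrite mcoeffZ mcoeffX eqxx mulr1.
Qed.

Lemma mcoeffXM m m' f : (m <= m')%MM -> ('X_[m' - m] * f)@_m' = f@_m.
Proof. by move=> le; rewrite mulrC -{1}(submK le) mcoeffMX. Qed.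

Lemma mcoeff0XM m f : m != 0%MM -> ('X_[m] * f)@_0%MM = 0.
Proof.
move=> m0; apply: memN_msupp_eq0; apply: contraNN m0.
case/msuppM_le/allpairsP => -[m1 m2] /= [/mem_msuppXP <- _] /esym/eqP.
by rewrite mnmD_eq0 => /andP[].
Qed.

(* Multigraded reading: the syzygy between X^p and X^q in degree M is not a combination of
   syzygies in degrees properly dividing M. As the resolution is only Z-graded, each image
   [aug F a 0] is split into its [P]-part and a [Q]-part; the [P]-part of a syzygy is then
   supported in [P] and in [Q], and its coefficient at M must vanish. *)
Lemma Tor1_obstruction (I : S -> Prop) P Q M p q :
  (forall m m', P m -> P (m' + m)%MM) -> (forall m m', Q m -> Q (m' + m)%MM) ->
  (forall f, I f -> supp_in (fun m => P m || Q m) f) ->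
  I 'X_[p] -> I 'X_[q] -> (p <= M)%MM -> (q <= M)%MM -> ~~ Q p -> ~~ P q ->
  (forall m, (m <= M)%MM -> P m -> Q m -> m = M) ->
  ~ Tor_vanishes I 1 (mdeg M)%:Z.
Proof.
move=> upP upQ IPQ Ip Iq pM qM nQp nPq MPQ [F hv].
pose Pcol : 'cV[S]_(rk F 0) := \col_a mrestrict P (aug F a 0).
pose Qcol := aug F - Pcol.
have Pcol_supp a : supp_in P (Pcol a 0).
  by move=> m; rewrite mcoeff_msupp mxE mcoeff_mrestrict; case: (P m); rewrite // eqxx.
have Qcol_supp a : supp_in Q (Qcol a 0).
  have Ia : I (aug F a 0).
    by apply/(aug_image F); exists (delta_mx 0 a); rewrite -rowE mxE.
  move=> m; rewrite mcoeff_msupp !mxE mcoeffB mcoeff_mrestrict.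
  case: ifP => [_|nP]; first by rewrite subrr eqxx.
  by rewrite subr0 -mcoeff_msupp => /(IPQ _ Ia); rewrite nP.
have mulPcol r (z : 'M[S]_(r, rk F 0)) b : supp_in P ((z *m Pcol) b 0).
  by rewrite mxE; apply: supp_in_sum => a _; apply: supp_inM.
have mulQcol r (z : 'M[S]_(r, rk F 0)) b : supp_in Q ((z *m Qcol) b 0).
  by rewrite mxE; apply: supp_in_sum => a _; apply: supp_inM.
have mulPcolE r (z : 'M[S]_(r, rk F 0)) : z *m Pcol = z *m aug F - z *m Qcol.
  by rewrite mulmxBr opprB addrC subrK.
have syzQ r (z : 'M[S]_(r, rk F 0)) b : z *m aug F = 0 -> supp_in Q ((z *m Pcol) b 0).
  by move=> za; rewrite mulPcolE za sub0r mxE; apply: supp_inN.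
have Pp : P p by have := IPQ _ Ip p; rewrite (negPf nQp) orbF; apply; apply/mem_msuppXP.
have Qq : Q q by have := IPQ _ Iq q; rewrite (negPf nPq); apply; apply/mem_msuppXP.
have divM m m' : (m <= m')%MM -> (m' = (m' - m) + m)%MM by move/submK.
have pM0 : (M - p)%MM != 0%MM.
  apply: contraNneq nQp => e; have := divM _ _ pM; rewrite e add0m => <-.
  by rewrite (divM _ _ qM); exact: upQ.
have qM0 : (M - q)%MM != 0%MM.
  apply: contraNneq nPq => e; have := divM _ _ qM; rewrite e add0m => <-.
  by rewrite (divM _ _ pM); exact: upP.
have /(aug_image F)[zp ezp] := Ip; have /(aug_image F)[zq ezq] := Iq.
(* The syzygy between X^p and X^q, lifted to F_0. *)
pose s := 'X_[M - p] *: zp - 'X_[M - q] *: zq.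
have entry (a b : S) (X Y : 'M[S]_1) : (a *: X - b *: Y) 0 0 = a * X 0 0 - b * Y 0 0.
  by rewrite !mxE.
have saug : s *m aug F = 0.
  apply/rowP => j; rewrite ord1 mulmxBl -!scalemxAl entry -ezp -ezq -!mpolyXD !submK //.
  by rewrite subrr mxE.
(* X^q contributes nothing because q is not in [P]; X^p contributes 1 because p is not in [Q]. *)
have sM : ((s *m Pcol) 0 0)@_M = 1.
  rewrite mulmxBl -!scalemxAl entry mcoeffB !mcoeffXM //.
  rewrite [X in _ - X](supp_in_coeff (mulPcol _ _ _)) ?subr0; last exact/negP.
  rewrite mulPcolE mxE [X in _ + X]mxE mcoeffB -ezp mcoeffX eqxx.
  by rewrite (supp_in_coeff (mulQcol _ _ _)) ?subr0 //; exact/negP.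
have [y ys] := (exact_aug s).1 saug.
(* The part of [y] in degree |M| modulo the variables. It is a cycle because the entries of [s] have
   no constant term. *)
pose y0 : 'rV[k]_(rk F 1) :=
  \row_a (if shift a == (mdeg M)%:Z then (y 0 a)@_0%MM else 0).
have diff00 i a b : (diff F i a b)@_0%MM != 0 -> shift a = shift b.
  by rewrite -mcoeff_msupp => /diff_homog ->; rewrite mdeg0 addr0.
have [||t _ ty] := hv y0.
- by move=> a; rewrite mxE; case: ifP => [/eqP//|_]; rewrite eqxx.
- rewrite /=; apply/rowP => b; rewrite mxE [RHS]mxE.
  have sb0 : (s 0 b)@_0%MM = 0 by rewrite !mxE mcoeffB !mcoeff0XM ?subr0.
  have [be|bne] := eqVneq (shift b) (mdeg M)%:Z.
    transitivity (s 0 b)@_0%MM => //; rewrite ys mxE raddf_sum; apply: eq_bigr => a _; rewrite !mxE /= rmorphM /=.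
    have [->|/diff00 ->] := eqVneq (diff F 0 a b)@_0%MM 0; first by rewrite !mulr0.
    by rewrite be eqxx.
  rewrite big1 // => a _; rewrite !mxE.
  have [->|/diff00 ->] := eqVneq (diff F 0 a b)@_0%MM 0; first by rewrite mulr0.
  by rewrite (negPf bne) mul0r.
(* Subtracting a lift of the boundary keeps the image [s] and removes the constant terms in degree
   |M|. *)
pose y' := y - map_mx (@mpolyC n k) t *m diff F 1.
have ys' : s = y' *m diff F 0.
  rewrite mulmxBl -ys (_ : _ *m diff F 0 = 0) ?subr0 //.
  by apply/exact_diff; eexists.
have y'0 a : shift a = (mdeg M)%:Z -> (y' 0 a)@_0%MM = 0.
  move=> ae; have /rowP/(_ a) := ty; rewrite mxE ae eqxx 3!mxE mcoeffB => ->.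
  rewrite mxE raddf_sum /= -sumrB big1 // => c _.
  by rewrite !mxE rmorphM /= mcoeffC eqxx mulr1 subrr.
(* A contribution at M = m1 + m2 has m2 in both [P] and [Q], so m2 = M and m1 = 0: it would need a
   constant term of [y'] in degree |M|. *)
have := sM; rewrite ys' -mulmxA mxE raddf_sum big1 => [/esym/eqP|a _]; first by rewrite oner_eq0.
apply: memN_msupp_eq0; apply/negP => /msuppM_le/allpairsP[[m1 m2] /= [h1 h2 eM]].
have rows : diff F 0 *m aug F = 0.
  apply/row_matrixP => b; rewrite row_mul row0; apply/exact_aug.
  by exists (delta_mx 0 b); rewrite -rowE.
have m2M : m2 = M.
  apply: MPQ; first by rewrite eM; exact: lem_addl.
    exact: mulPcol h2.
  exact: syzQ rows _ h2.
have m10 : m1 = 0%MM.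
  by apply/(@addIm _ M); rewrite add0m {2}eM m2M.
move: h1; rewrite m10 mcoeff_msupp y'0 ?eqxx // -m2M.
suff : supp_in (fun m => shift a = (mdeg m)%:Z) ((diff F 0 *m Pcol) a 0) by apply.
rewrite mxE; apply: supp_in_sum => b _ m /msuppM_le/allpairsP[[m3 m4] /= [h3 h4 ->]].
rewrite (diff_homog h3) mdegD PoszD addrC; congr (_ + _).
move: h4; rewrite mcoeff_msupp mxE mcoeff_mrestrict; case: ifP => _; last by rewrite eqxx.
by rewrite -mcoeff_msupp => /aug_homog.
Qed.

End TorObstruction.

(** * Linear relations of a lexsegment ideal *)

Section Form.
Variable n : nat.
Implicit Types (m a b u v w : 'X_{1..n.+1}) (i j l : 'I_n.+1).
Local Notation x0 := (@ord0 n).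
Local Notation xN := (@ord_max n).

Section Crossing.
Variables (k : fieldType) (d : nat) (u v : 'X_{1..n.+1}) (l : 'I_n.+1).
Hypotheses (ud : mdeg u = d) (vd : mdeg v = d) (u0 : u x0 != 0) (v0 : v x0 = 0).
Hypotheses (lN : l < xN) (vl : v l != 0) (vlt : forall j, j < l -> v j = 0).
Local Notation I := (mon_ideal (k := k) (lexseg d u v)).

(* The divisors of degree d of the lcm of y^d and x z^(d-1), y being the variable of index l. *)
Definition low e : 'X_{1..n.+1} := (U_(l) *+ e + U_(xN) *+ (d - e))%MM.
Definition high e : 'X_{1..n.+1} := (U_(x0) + (U_(l) *+ e + U_(xN) *+ (d.-1 - e)))%MM.

Lemma l_gt0 : 0 < l.
Proof.
rewrite lt0n; apply: contra_neqN vl => /eqP e.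
by rewrite (_ : l = x0) //; exact: val_inj.
Qed.

Lemma mnmU3E p q r j : (U_(x0) *+ p + (U_(l) *+ q + U_(xN) *+ r))%MM j =
  if j == x0 then p else if j == l then q else if j == xN then r else 0.
Proof.
rewrite !mnmDE !mulmnE !mnm1E; have := l_gt0; move: (lN).
by rewrite -!val_eqE /= => h1 h2; do 6?case: eqP => //=; lia.
Qed.

Lemma highE e : high e = (U_(x0) *+ 1 + (U_(l) *+ e + U_(xN) *+ (d.-1 - e)))%MM.
Proof. by rewrite mulm1n. Qed.

Lemma lowE e : low e = (U_(x0) *+ 0 + (U_(l) *+ e + U_(xN) *+ (d - e)))%MM.
Proof. by rewrite mulm0n add0m. Qed.

Lemma mdegU3 p q r : mdeg (U_(x0) *+ p + (U_(l) *+ q + U_(xN) *+ r))%MM = p + (q + r).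
Proof. by rewrite !mdegD !mdegMn !mdeg1 !mul1n. Qed.

Lemma d_gt0 : 0 < d.
Proof. by rewrite -ud lt0n mdeg_eq0; apply: contraNneq u0 => ->; rewrite mnm0E. Qed.

Lemma u_sub_deg : mdeg (u - U_(x0)) = d.-1.
Proof. by apply: (mdeg_subU u0); rewrite ud prednK // d_gt0. Qed.

Lemma high0 : (high 0 <= u)%O.
Proof.
by rewrite /high mulm0n add0m subn0 -(subUK u0) lemc_add2r; exact: le_max_pow u_sub_deg.
Qed.

Lemma high_mono e e' : e <= e' -> e' <= d.-1 -> (high e <= high e')%O.
Proof.
rewrite leq_eqVlt => /orP[/eqP->//|lt] le; apply: ltW; apply: (@lt_at _ _ _ l).
- by rewrite !highE !mdegU3; lia.
- move=> j jl; have jl' : (j == l) = false by rewrite -val_eqE /=; lia.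
  have jN : (j == xN) = false by move: (lN); rewrite -val_eqE /=; lia.
  by rewrite !highE !mnmU3E jl' jN.
- by rewrite !highE !mnmU3E eqxx; case: ifP => // /eqP e0; have := l_gt0; rewrite e0.
Qed.

Lemma low_d : (v <= low d)%O.
Proof.
have e : mdeg (low d) = mdeg v by rewrite lowE mdegU3 vd; lia.
rewrite leNgt; apply/negP => lt; have /(ltmcP e)[i eq hi] := lt.
have li : l <= i by rewrite leqNgt; apply/negP => /vlt h; rewrite h in hi.
suff ev : low d = v by rewrite ev ltxx in lt.
apply: lem_mdeg_eq => //; apply/mnm_lepP => j; rewrite lowE mnmU3E subnn if_same.
case: ifP => // _; case: ifP => // /eqP->.
have [il|li'] := leqP i l.
  have il' : i = l by apply: val_inj; apply/eqP; rewrite eqn_leq il.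
  move: hi; rewrite il' lowE mnmU3E eqxx; case: ifP => [/eqP e0|_ /ltnW //].
  by have := l_gt0; rewrite e0.
by rewrite -eq // lowE mnmU3E eqxx; case: ifP => // /eqP e0; have := l_gt0; rewrite e0.
Qed.

Lemma dvd_U3 m p q r : (m <= U_(x0) *+ p + (U_(l) *+ q + U_(xN) *+ r))%MM ->
  m = (U_(x0) *+ m x0 + (U_(l) *+ m l + U_(xN) *+ m xN))%MM.
Proof.
move/mnm_lepP => h; apply/mnmP => j; have := h j; rewrite !mnmU3E.
by case: eqP => [->//|_]; case: eqP => [->//|_]; case: eqP => [->//|_]; lia.
Qed.

(** Let c be least with y^c z^(d-c) >= v and a greatest with x y^a z^(d-1-a) <= u. If a < c - 1, the
    lcm M of these two has degree d + c - a > d + 1, and the generators dividing M split into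
    multiples of y^c and multiples of x z^(d-1-a), which yields a class of Tor_1 in degree |M|. *)
Lemma linear_resolution_crossing : ~ (v <= low 0)%O -> linear_resolution d I ->
  exists e, [/\ 0 < e <= d, (v <= low e)%O & (high e.-1 <= u)%O].
Proof.
move=> nlow0 lin; apply: NNPP => no.
have hd := d_gt0; have hl := l_gt0; have hN : l < n := lN.
have exlow : exists e, (v <= low e)%O by exists d; exact: low_d.
case: (ex_minnP exlow) => c vc cmin.
have cd : c <= d by apply: cmin; exact: low_d.
have c0 : 0 < c by rewrite lt0n; apply/eqP => e0; apply: nlow0; rewrite -e0.
have exhigh : exists e, (e <= d.-1) && (high e <= u)%O by exists 0; rewrite high0.
have bhigh e : (e <= d.-1) && (high e <= u)%O -> e <= d.-1 by case/andP.
case: (ex_maxnP exhigh bhigh) => a /andP[ad au] amax.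
have ac : a < c.-1.
  rewrite ltnNge; apply/negP => ca; apply: no; exists c; split=> //; first by rewrite c0.
  by apply: le_trans au; exact: high_mono.
pose M : 'X_{1..n.+1} := (U_(x0) *+ 1 + (U_(l) *+ c + U_(xN) *+ (d.-1 - a)))%MM.
(* Monomials not dividing M are put in both predicates. Among the generators dividing M, those prime
   to x are in [Q] by minimality of c, the others in [P] by maximality of a. *)
pose P m := ~~ (m <= M)%MM || ((0 < m x0) && (d.-1 - a <= m xN)).
pose Q m := ~~ (m <= M)%MM || (c <= m l).
have lx0 : (l == x0) = false by rewrite -val_eqE /=; lia.
have Nx0 : (xN == x0) = false by rewrite -val_eqE /=; lia.
have Nl : (xN == l) = false by rewrite -val_eqE /=; lia.
have Mx0 : M x0 = 1 by rewrite /M mnmU3E eqxx.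
have Ml : M l = c by rewrite /M mnmU3E eqxx lx0.
have MN : M xN = d.-1 - a by rewrite /M mnmU3E eqxx Nx0 Nl.
have Mdeg : mdeg M = 1 + (c + (d.-1 - a)) by rewrite mdegU3.
have divM m m' : (m' + m <= M)%MM -> (m <= M)%MM by exact: lepm_trans (lem_addl _ _).
have upP m m' : P m -> P (m' + m)%MM.
  rewrite /P !mnmDE; have [/divM->|//] := boolP (m' + m <= M)%MM; move=> /= /andP[]; lia.
have upQ m m' : Q m -> Q (m' + m)%MM.
  rewrite /Q !mnmDE; have [/divM->|//] := boolP (m' + m <= M)%MM; rewrite /=; lia.
have PQL m : lexseg d u v m -> P m || Q m.
  move=> /(lexsegE _ ud vd)[md /andP[vm mu]].
  rewrite /P /Q; have [mM|//] := boolP (m <= M)%MM; rewrite /=.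
  have em := dvd_U3 mM; have := congr1 (@mdeg _) em; rewrite mdegU3 md => ed.
  have m0 : m x0 <= 1 by rewrite -Mx0; exact: (mnm_lepP mM).
  have [e0|m0'] := posnP (m x0); rewrite /=.
    apply: cmin; rewrite lowE (_ : d - m l = m xN) -?e0 -?em //.
    by clear - ed e0; lia.
  have e1 : m x0 = 1 by apply/eqP; rewrite eqn_leq m0.
  have : m l <= a.
    apply: amax; rewrite highE (_ : d.-1 - m l = m xN) -?e1 -?em ?mu;
      by clear - ed e1; lia.
  by clear - ed e1; lia.
have hiL : lexseg d u v (high a).
  apply/lexsegE => //; rewrite highE mdegU3 -highE au; split; first lia.
  rewrite andbT ltW //; apply: lt_at0; first by rewrite highE mdegU3; lia.
  by rewrite v0 highE mnmU3E eqxx.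
have loL : lexseg d u v (low c).
  apply/lexsegE => //; rewrite lowE mdegU3 -lowE vc; split; first lia.
  rewrite ltW //; apply: lt_at0; first by rewrite lowE mdegU3; lia.
  by rewrite lowE mnmU3E eqxx lt0n.
have hiM : (high a <= M)%MM.
  apply/mnm_lepP => j; rewrite highE !mnmU3E; clear - ac.
  by repeat case: ifP => // _; lia.
have loM : (low c <= M)%MM.
  apply/mnm_lepP => j; rewrite lowE !mnmU3E; clear - ac.
  by repeat case: ifP => // _; lia.
have IPQ f : I f -> supp_in (fun m => P m || Q m) f.
  move/mon_idealP => h m /h [b /PQL bPQ bm]; rewrite -(submK bm).
  by case/orP: bPQ => [/upP|/upQ] ->; rewrite ?orbT.
apply: (@Tor1_obstruction _ k I P Q M (high a) (low c)) => //.
- by apply/mon_idealX; exists (high a) => //; exact: lepm_refl.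
- by apply/mon_idealX; exists (low c) => //; exact: lepm_refl.
- by rewrite /Q hiM highE mnmU3E eqxx lx0 -ltnNge (leq_trans ac) ?leq_pred.
- by rewrite /P loM lowE mnmU3E eqxx.
- move=> m mM; rewrite /P /Q mM /= => /andP[h0 hN1] hl'.
  rewrite (dvd_U3 mM); apply/mnmP => j; rewrite /M !mnmU3E.
  have := mnm_lepP mM x0; have := mnm_lepP mM l; have := mnm_lepP mM xN.
  rewrite Mx0 Ml MN; clear - h0 hN1 hl'.
  by repeat case: ifP => // _; lia.
(* Here j = |M| - 1 is at least d + 1, because c - a >= 2. *)
have := lin 1 (Posz (mdeg M) - 1)%R; rewrite (_ : (Posz 1 + _)%R = Posz (mdeg M)).
  2: by clear; lia.
apply.
by apply/eqP => e; clear - e Mdeg ac ad hd; lia.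
Qed.

End Crossing.

(** The last clause amounts to v = y z^(d-1), in the form in which the ordering of the generators
    uses it. *)
Lemma linear_resolution_form (k : fieldType) d u v : mdeg u = d -> mdeg v = d ->
  u x0 != 0 -> v x0 = 0 -> ~ exchangeable d u v ->
  linear_resolution d (mon_ideal (k := k) (lexseg d u v)) ->
  exists l, [/\ u x0 = 1, forall j : 'I_n.+1, 0 < j <= l -> u j = 0 &
    forall m, mdeg m = d -> (v <= m)%O <-> exists2 j : 'I_n.+1, j <= l & m j != 0].
Proof.
move=> ud vd u0 v0 nex lin.
have [w [wd wv wu]] : exists w, [/\ mdeg w = d, (w < v)%O &
    forall i, w i != 0 -> (u < (U_(x0) + (w - U_(i)))%MM)%O].
  apply: NNPP => no; apply: nex => w wd wv; apply: NNPP => no'; apply: no.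
  exists w; split=> // i wi; rewrite ltNge; apply/negP => le; apply: no'.
  by exists i.
have d0 := d_gt0 ud u0.
have [|i0 vi0] := @mdeg_neq0 _ v; first by rewrite vd -lt0n.
pose l := [arg min_(l < i0 | v l != 0) (l : nat)].
have [vl lmin] : v l != 0 /\ forall i, v i != 0 -> l <= i.
  by rewrite /l; case: arg_minnP.
have vlt (j : 'I_n.+1) : j < l -> v j = 0.
  by move=> jl; apply: contraTeq jl => /lmin; rewrite -leqNgt.
(* No monomial of degree d lies below z^d, whereas w < v. In particular y is not the last
   variable. *)
have nlow : ~ (v <= (U_(xN) *+ d)%MM)%O.
  by move=> h; have := lt_le_trans wv h; rewrite ltNge le_max_pow.
have lN : l < xN.
  rewrite ltn_neqAle leq_ord andbT; apply/eqP => lN; apply: nlow.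
  suff -> : v = (U_(xN) *+ d)%MM by [].
  apply: lem_mdeg_eq; last by rewrite mdegMn mdeg1 mul1n.
  apply/mnm_lepP => j; rewrite mulmnE mnm1E; case: eqP => [<-|ne].
    by rewrite -vd mdegE (bigD1 xN) //= mul1n leq_addr.
  rewrite vlt // lN ltn_neqAle leq_ord andbT; apply/eqP => e; apply: ne; exact/esym/val_inj.
have l0 := l_gt0 v0 vl.
have [|e [e1 vlow uhigh]] := linear_resolution_crossing ud vd u0 v0 lN vl vlt _ lin.
  by rewrite /low mulm0n add0m subn0.
have w0 : w x0 = 0 by apply: le_zero0 (ltW wv) v0; rewrite wd vd.
have wlt (j : 'I_n.+1) : j < l -> w j = 0.
  by apply: (le_zero_prefix _ (ltW wv) vlt); rewrite wd vd.
(* With this common factor R, the crossing reads v <= yR and xR <= u. *)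
pose R : 'X_{1..n.+1} := (U_(l) *+ e.-1 + U_(xN) *+ (d - e))%MM.
have lowR : low d l e = (U_(l) + R)%MM.
  by rewrite /low /R addmA -mulmS prednK //; case/andP: e1.
have highR : high d l e.-1 = (U_(x0) + R)%MM.
  by rewrite /high /R (_ : d.-1 - e.-1 = d - e) //; lia.
(* If y divided w, then w < v <= yR would give x w/y < xR <= u, against the choice of w. *)
have wl : w l = 0.
  apply/eqP/negPn/negP => wl; have := le_lt_trans uhigh (wu l wl).
  rewrite highR ltmc_add2r ltNge => /negP; apply; apply: ltW.
  have := lt_le_trans wv vlow; rewrite lowR -{1}(subUK wl); by rewrite ltmc_add2r.
have [|i wi] := @mdeg_neq0 _ w; first by rewrite wd -lt0n.
have wdd : mdeg w = d.-1.+1 by rewrite wd prednK.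
have wlt' (j : 'I_n.+1) : j < l.+1 -> (w - U_(i))%MM j = 0.
  rewrite ltnS leq_eqVlt mnmBE => /orP[/eqP/val_inj->|/wlt->]; by rewrite ?wl.
(* Cancelling x in u < x w/x_i bounds u/x by a monomial in the variables after y. So u/x, and then R
   <= u/x, involve only such variables, whence e = 1. *)
have uw : ((u - U_(x0))%MM < (w - U_(i))%MM)%O.
  by have := wu i wi; rewrite -{1}(subUK u0) ltmc_add2r.
have ult (j : 'I_n.+1) : j < l.+1 -> (u - U_(x0))%MM j = 0.
  by apply: (le_zero_prefix _ (ltW uw) wlt'); rewrite (mdeg_subU wi wdd) (u_sub_deg ud u0).
have Ru : (R <= (u - U_(x0))%MM)%O.
  by move: uhigh; rewrite highR -{1}(subUK u0) lemc_add2r.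
have Rl : R l = 0.
  apply: (le_zero_prefix _ Ru ult) => //.
  by rewrite (u_sub_deg ud u0) mdegD !mdegMn !mdeg1; lia.
have ee : e = 1.
  by move: Rl; rewrite /R mnmDE !mulmnE !mnm1E eqxx; lia.
have uE j : u j = (x0 == j) + (u - U_(x0))%MM j by rewrite -{1}(subUK u0) mnmDE mnm1E.
exists l; split=> [|j /andP[j0 jl]|m md].
- by rewrite uE eqxx ult.
- by rewrite uE ult // -val_eqE /=; lia.
split=> [vm|[j jl mj]]; last first.
  apply: le_trans vlow _; rewrite lowR; apply: le_trans (leU _ jl) _.
  rewrite -{1}(subUK mj) lemc_add2r /R ee mulm0n add0m subn1.
  by apply: le_max_pow; apply: (mdeg_subU mj); rewrite md prednK.
apply: NNPP => no; move: vm; rewrite leNgt => /negP; apply.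
have m0 (j : 'I_n.+1) : j <= l -> m j = 0.
  by move=> jl; apply/eqP/negPn/negP => mj; apply: no; exists j.
apply: (@lt_at _ _ _ l); first by rewrite md vd.
  by move=> j jl; rewrite vlt // m0 // ltnW.
by rewrite m0 // lt0n.
Qed.

End Form.

(** * Ordering the generators to obtain linear quotients *)

Section Criterion.
Local Open Scope ring_scope.
Variables (n : nat) (k : fieldType).
Local Notation S := {mpoly k[n]}.
Implicit Types (I : S -> Prop) (s : seq 'X_{1..n}).

(** If an earlier b divides g m, the exchange gives x_t with x_t g a multiple of an earlier h, and
    x_t divides m because b has the larger exponent at t. Such x_t generate the colon ideal. Equal
    degrees and [uniq s] give minimality. *)
Lemma linear_quotients_exchange I s d :
  same_ideal I (mon_ideal (fun m => m \in s)) -> uniq s ->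
  (forall m, m \in s -> mdeg m = d) ->
  (forall i b, (i < size s)%N -> b \in take i s -> exists h t t',
    [/\ h \in take i s, (U_(t) + nth 0 s i = U_(t') + h)%MM & (nth 0%MM s i t < b t)%N]) ->
  linear_quotients I.
Proof.
move=> Is us sd ex; exists s; split.
  split=> // m ms; have Xs : mon_ideal (k := k) (fun m => m \in s) 'X_[m].
    by apply/mon_idealX; exists m => //; exact: lepm_refl.
  move/Is in Xs; move=> /(_ 'X_[m])[/(_ Xs) /mon_idealX[a am le] _].
  have e : a = m by apply: lem_mdeg_eq le _; rewrite !sd //; exact: mem_rem am.
  by move: am; rewrite e mem_rem_uniqF.
move=> i /andP[_ si]; pose g := nth 0%MM s i.
exists [set t | has (fun h => [exists t', (U_(t) + g)%MM == (U_(t') + h)%MM]) (take i s)].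
move=> f; rewrite var_idealP /colon mon_idealP; split=> h m.
  move=> mf; have [|b bs bm] := h (g + m)%MM.
    by rewrite mcoeff_msupp mcoeffMX -mcoeff_msupp.
  have [h' [t [t' [hs e lt]]]] := ex i b si bs; exists t.
    by rewrite inE; apply/hasP; exists h' => //; apply/existsP; exists t'; apply/eqP.
  have := mnm_lepP bm t; rewrite mnmDE -lt0n; move: lt; rewrite -/g; lia.
move=> /msuppM_le/allpairsP[[m1 m2] /= [/h[t + m1t] /mem_msuppXP <- ->]].
rewrite inE => /hasP[h' hs /existsP[t' /eqP e]]; exists h' => //.
apply: lepm_trans (lem_addl U_(t') _) _; rewrite -e.
apply/mnm_lepP => j; rewrite !mnmDE mnm1E leq_add2r; case: eqP => // <-.
by rewrite lt0n.
Qed.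

End Criterion.

Section Order.
Variable n : nat.
Implicit Types (m a b u v w h : 'X_{1..n.+1}) (i j l : 'I_n.+1).
Local Notation x0 := (@ord0 n).

(** Raising a monomial within those prime to x keeps it below u, and lowering one within the
    multiples of x keeps it above v; hence the opposite directions of the two blocks. *)
Definition quotient_order a b : bool :=
  if a x0 == 0 then (b x0 != 0) || (b <= a)%O else (b x0 != 0) && (a <= b)%O.

Lemma quotient_order_total : total quotient_order.
Proof.
move=> a b; rewrite /quotient_order; have := le_total a b.
by do 2!case: eqP => _ //=; rewrite // orbC.
Qed.

Lemma quotient_order_trans : transitive quotient_order.
Proof.
move=> b a c; rewrite /quotient_order.
do 3!case: eqP => _ //=; first by move=> h1 h2; exact: le_trans h2 h1.
exact: le_trans.
Qed.

Lemma quotient_order_anti : antisymmetric quotient_order.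
Proof.
move=> a b; rewrite /quotient_order.
by do 2!case: eqP => _ //=; move/le_anti.
Qed.

Lemma exchange_deg (g : 'X_{1..n.+1}) i j : g j != 0 -> mdeg (U_(i) + g - U_(j)) = mdeg g.
Proof.
move=> gj; apply: (mdeg_subU (i := j)); last by rewrite mdegD mdeg1.
by rewrite mnmDE addn_eq0 negb_and gj orbT.
Qed.

Lemma exchangeE (g : 'X_{1..n.+1}) i j : g j != 0 -> (U_(j) + (U_(i) + g - U_(j)) = U_(i) + g)%MM.
Proof. by move=> gj; apply: subUK; rewrite mnmDE addn_eq0 negb_and gj orbT. Qed.

Lemma exchange_gt (g : 'X_{1..n.+1}) i j : i < j -> g j != 0 ->
  (g < (U_(i) + g - U_(j))%MM)%O.
Proof.
move=> ij gj; apply: (@lt_at _ _ _ i); first by rewrite exchange_deg.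
  move=> c ci; rewrite mnmBE mnmDE !mnm1E -!val_eqE /=; lia.
by rewrite mnmBE mnmDE !mnm1E eqxx -!val_eqE /=; lia.
Qed.

Lemma exchange_lt (g : 'X_{1..n.+1}) i j : j < i -> g j != 0 ->
  ((U_(i) + g - U_(j))%MM < g)%O.
Proof.
move=> ji gj; apply: (@lt_at _ _ _ j); first by rewrite exchange_deg.
  move=> c cj; rewrite mnmBE mnmDE !mnm1E -!val_eqE /=; lia.
by rewrite mnmBE mnmDE !mnm1E eqxx -!val_eqE /=; lia.
Qed.

Lemma form_linear_quotients (k : fieldType) d u v l : mdeg u = d -> mdeg v = d ->
  u x0 = 1 -> v x0 = 0 -> (forall j : 'I_n.+1, 0 < j <= l -> u j = 0) ->
  (forall m, mdeg m = d -> (v <= m)%O <-> exists2 j : 'I_n.+1, j <= l & m j != 0) ->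
  linear_quotients (mon_ideal (k := k) (lexseg d u v)).
Proof.
move=> ud vd u0 v0 ul vE.
pose L := [seq val c | c in [pred c : 'X_{1..n.+1 < d.+1} |
  (mdeg c == d) && (v <= val c <= u)%O]].
have memL m : m \in L <-> lexseg d u v m.
  rewrite lexsegE //; split=> [/imageP[m']|[md vmu]].
    by rewrite inE => /andP[/eqP md vmu] ->.
  apply/imageP; have md' : mdeg m < d.+1 by rewrite md.
  by exists (BMultinom md'); rewrite ?inE //= md eqxx.
pose s := sort quotient_order L.
have mems m : m \in s <-> mdeg m = d /\ (v <= m <= u)%O.
  by rewrite mem_sort memL lexsegE.
have us : uniq s.
  by rewrite sort_uniq /L map_inj_uniq ?enum_uniq //; exact: val_inj.
have ss : sorted quotient_order s by exact: sort_sorted quotient_order_total _.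
apply: (@linear_quotients_exchange _ _ _ s d) => //.
- by apply: eq_mon_ideal => m; rewrite mem_sort memL.
- by move=> m /mems[].
move=> i b si bs; set g := nth _ s i.
have gs : g \in s by exact: mem_nth.
have ig : index g s = i by rewrite index_uniq.
have before h : h \in s -> quotient_order h g -> h != g -> h \in take i s.
  move=> hs hg ne; rewrite in_take // ltnNge; apply: contraNN ne.
  rewrite -{1}ig leq_eqVlt => /orP[/eqP e|lt].
    by rewrite -(nth_index 0%MM gs) e nth_index.
  apply/eqP/quotient_order_anti; rewrite hg /=.
  exact: (sorted_ltn_index quotient_order_trans ss).
have bs' : b \in s by exact: mem_take bs.
have bg : quotient_order b g.
  apply: (sorted_ltn_index quotient_order_trans ss) => //.
  by rewrite ig -in_take.
have nbg : b != g.
  by apply/eqP => e; move: bs; rewrite in_take // e ig ltnn.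
suff [t [t' [gt' hs hg ne lt]]] : exists t t', [/\ g t' != 0,
    (U_(t) + g - U_(t'))%MM \in s, quotient_order (U_(t) + g - U_(t')) g,
    (U_(t) + g - U_(t'))%MM != g & g t < b t].
  by exists (U_(t) + g - U_(t'))%MM, t, t'; rewrite exchangeE // before.
clearbody g s L; have /mems[gd /andP[vg gu]] := gs; have /mems[bd /andP[vb bu]] := bs'.
have dgb : mdeg g = mdeg b by rewrite gd bd.
(* Both prime to x, g < b: with t the first difference and p a later index where g exceeds b, x_t
   g/x_p is larger than g and prime to x. *)
have [g0|g0] := eqVneq (g x0) 0.
  have b0 : b x0 = 0.
    by move: bg; rewrite /quotient_order g0 eqxx /=; case: eqP.
  have lt : (g < b)%O.
    rewrite lt_neqAle eq_sym nbg /=.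
    by move: bg; rewrite /quotient_order g0 b0 eqxx.
  have /(ltmcP dgb)[t eq lt'] := lt; have [p tp bp] := lt_ex_gt dgb eq lt'.
  have gp : g p != 0 by rewrite -lt0n; exact: leq_ltn_trans bp.
  have t0 : (t == x0) = false by apply/eqP => e; rewrite e g0 b0 in lt'.
  have hd := exchange_deg t gp.
  have h0 : (U_(t) + g - U_(p))%MM x0 = 0.
    by rewrite mnmBE mnmDE mnm1E t0 g0.
  have gh : (g < (U_(t) + g - U_(p))%MM)%O by exact: exchange_gt.
  exists t, p; split=> //.
  - apply/mems; rewrite hd gd; split=> //; rewrite (le_trans vg (ltW gh)) ltW //.
    by apply: lt_at0; rewrite ?hd ?gd ?ud // h0 u0.
  - by rewrite /quotient_order h0 eqxx g0 eqxx ltW.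
  - by rewrite gt_eqF.
have g1 : g x0 = 1.
  apply/eqP; rewrite eqn_leq lt0n g0 andbT -u0 leqNgt; apply/negP => lt.
  by have := lt_at0 (etrans ud (esym gd)) lt; rewrite ltNge gu.
(* Only g divisible by x: b >= v yields x_t dividing b with t at most [l], and g <= u makes g prime
   to x_t. Then x_t g/x is prime to x and still >= v. *)
have [b0|b0] := eqVneq (b x0) 0.
  have [t tl bt] : exists2 t : 'I_n.+1, t <= l & b t != 0 by apply/vE.
  have t0 : 0 < t.
    rewrite lt0n; apply: contraNneq bt => e.
    by rewrite (_ : t = x0) ?b0 //; exact: val_inj.
  have gt0 : g t = 0.
    move: gu; rewrite le_eqVlt => /orP[/eqP->|]; first by rewrite ul // t0.
    have gud : mdeg g = mdeg u by rewrite gd ud.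
    case/(ltmcP gud) => c eq lt; have [tc|ct] := ltnP t c; first by rewrite eq // ul ?t0.
    have [c0|c0] := posnP c.
      by move: lt; rewrite (_ : c = x0) ?g1 ?u0 //; exact: val_inj.
    by rewrite (ul c) // ?c0 ?(leq_trans ct) in lt.
  have hd := exchange_deg t g0.
  have tx0 : (t == x0) = false by apply/eqP => e; rewrite e in t0.
  have h0 : (U_(t) + g - U_(x0))%MM x0 = 0.
    by rewrite mnmBE mnmDE !mnm1E tx0 eqxx g1.
  exists t, x0; split=> //; last by rewrite gt0 lt0n.
  - apply/mems; rewrite hd gd; split=> //; apply/andP; split.
      apply/vE; first by rewrite hd.
      by exists t; rewrite // mnmBE mnmDE !mnm1E eqxx [_ == t]eq_sym tx0 gt0.
    by apply: ltW; apply: lt_at0; rewrite ?hd ?gd ?ud // h0 u0.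
  - by rewrite /quotient_order h0 eqxx g0.
  - by apply: contraNneq g0 => <-; rewrite h0.
have b1 : b x0 = 1.
  apply/eqP; rewrite eqn_leq lt0n b0 andbT -u0 leqNgt; apply/negP => lt.
  by have := lt_at0 (etrans ud (esym bd)) lt; rewrite ltNge bu.
(* Both divisible by x, b < g: with p the first difference and t a later index where b exceeds g,
   x_t g/x_p is smaller than g and keeps the factor x. *)
have lt : (b < g)%O.
  by rewrite lt_neqAle nbg /=; move: bg; rewrite /quotient_order (negPf b0) g0.
have /(ltmcP (esym dgb))[p eq lt'] := lt.
have [t pt gt] := lt_ex_gt (esym dgb) eq lt'.
have gp : g p != 0 by rewrite -lt0n; exact: leq_ltn_trans lt'.
have p0 : (p == x0) = false by apply/eqP => e; rewrite e g1 b1 in lt'.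
have hd := exchange_deg t gp.
have t0 : (t == x0) = false by apply/eqP => e; rewrite e in pt.
have h0 : (U_(t) + g - U_(p))%MM x0 = 1.
  by rewrite mnmBE mnmDE !mnm1E t0 p0 g1.
have hg : ((U_(t) + g - U_(p))%MM < g)%O by exact: exchange_lt.
exists t, p; split=> //.
- apply/mems; rewrite hd gd; split=> //; rewrite (le_trans (ltW hg) gu) andbT ltW //.
  by apply: lt_at0; rewrite ?hd ?gd ?vd // h0 v0.
- by rewrite /quotient_order h0 /= g0 ltW.
- by rewrite lt_eqF.
Qed.

End Order.

Theorem theorem2p2p1 (k : fieldType) (n d : nat) (hd : (2 <= d)%N)
    (u v : 'X_{1..n.+1})
    (hu : mdeg u = d) (hv : mdeg v = d)
    (hu1 : u ord0 <> 0%N) (hv1 : v ord0 = 0%N)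
    (hI : ~ completely_lexsegment (lexseg d u v)) :
  let I := mon_ideal (k := k) (lexseg d u v) in
  linear_resolution d I <-> linear_quotients I.
Proof.
move=> I; split; last first.
  by apply: linear_quotients_linear_resolution => a /(lexsegE _ hu hv)[].
move/eqP in hu1 => lin.
(* In a single variable v would be 1, against d >= 2. *)
have n0 : 0 < n.
  case: n u v hu hv hu1 hv1 hI @I lin => // u' v' _ v'd _ v'0 _ _ _.
  have : mdeg v' = 0 by rewrite mdegE big_ord1.
  by lia.
have nex : ~ exchangeable d u v.
  by move=> ex; apply: hI; exact: exchangeable_completely_lexsegment.
have [l [u0 ul vE]] := linear_resolution_form hu hv hu1 hv1 nex lin.
exact: form_linear_quotients vE.
Qed.
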